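(* Let $G$ be a finite simple connected graph without isolated vertices (i.e. with at least one edge), and let $I(G)$ be its edge ideal. Then \[ \operatorname{vstab}(I(G))=\min\{t\ge1\mid v(I(G)^t)=2t-1\}. \]
   Context: Let $G$ be a finite simple graph on $V(G)=\{1,\dots,n\}$, $\mathrm{k}$ a field and $S=\mathrm{k}[x_1,\dots,x_n]$. The edge ideal is $I(G)=(x_ix_j\mid\{i,j\}\in E(G))\subseteq S$. For an ideal $I$ of $S$ and $P\in\operatorname{Ass}(I)$ (associated primes of $S/I$), $v_P(I)=\min\{\deg f\mid f\in S,\ I:f=P\}$, and $v(I)=\min\{v_P(I)\mid P\in\operatorname{Ass}(I)\}$. For a homogeneous ideal $I$ the function $t\mapsto v(I^t)$ is eventually linear; $\operatorname{vstab}(I)$ denotes the smallest integer $t_0\ge1$ such that $t\mapsto v(I^t)$ is linear (of the form $at+b$) for all $t\ge t_0$. *)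

(* Defs.v *)
From HB Require Import structures.
From mathcomp Require Import all_boot all_order all_algebra.
From mathcomp Require Import mpoly.

Set Implicit Arguments.
Unset Strict Implicit.
Unset Printing Implicit Defensive.

Import GRing.Theory.

Local Open Scope ring_scope.

(* [least A m] reads "min A exists and equals m"; minima are stated through
   this functional relation so that no default value is needed when A is
   empty. *)
Definition least (A : nat -> Prop) (m : nat) : Prop :=
  A m /\ forall j, A j -> (m <= j)%N.

Lemma least_unique (A : nat -> Prop) (m m' : nat) :
  least A m -> least A m' -> m = m'.
Proof.
move=> [Am lem] [Am' lem'].
by apply/eqP; rewrite eqn_leq lem // lem'.
Qed.

(* Ideals are Prop-valued predicates: the structures of ring_quotient are
   boolean, that is, restricted to ideals with decidable membership, and they
   exclude the unit ideal. *)
Section Ideals.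
Variable R : comNzRingType.
Implicit Types I J P : R -> Prop.

Definition is_ideal I : Prop :=
  [/\ I 0, forall f g, I f -> I g -> I (f + g) & forall c f, I f -> I (c * f)].

Definition is_prime P : Prop :=
  [/\ is_ideal P, ~ P 1 & forall f g, P (f * g) -> P f \/ P g].

Definition ideal_gen (A : R -> Prop) : R -> Prop :=
  fun f => exists2 s : seq (R * R),
    forall p, p \in s -> A p.2 & f = \sum_(p <- s) p.1 * p.2.

Definition ideal_pow I (t : nat) : R -> Prop :=
  ideal_gen (fun f => exists2 g : 'I_t -> R,
    forall i, I (g i) & f = \prod_(i < t) g i).

(* I : f *)
Definition colon I (f : R) : R -> Prop := fun g => I (g * f).

Definition ideal_eq I J : Prop := forall g, I g <-> J g.

(* P \in Ass(R/I): since I : f is the annihilator of the class of f in R/I *)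
Definition is_Ass I P : Prop :=
  is_prime P /\ exists f, ideal_eq (colon I f) P.

End Ideals.

Section VNumber.
Variables (n : nat) (k : fieldType).
Local Notation S := {mpoly k[n]}.
Implicit Types I P : S -> Prop.

(* [has_deg f d]: f is nonzero, of total degree d (msize 0 = 0) *)
Definition has_deg (f : S) (d : nat) : Prop := msize f = d.+1.

(* v_P(I) = d *)
Definition is_local_vnumber I P (d : nat) : Prop :=
  least (fun d' => exists2 f : S, has_deg f d' & ideal_eq (colon I f) P) d.

(* v(I) = d *)
Definition is_vnumber I (d : nat) : Prop :=
  least (fun d' => exists2 P, is_Ass I P & is_local_vnumber I P d') d.

(* The coefficients are integers because b may be negative; nothing is lost,
   as a line taking integer values at consecutive integers has integer
   coefficients. *)
Definition v_linear_from I (t0 : nat) : Prop :=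
  exists a b : int, forall t, (t0 <= t)%N ->
    exists2 d, is_vnumber (ideal_pow I t) d & d%:Z = a * t%:Z + b.

(* vstab(I) = t0 *)
Definition is_vstab I (t0 : nat) : Prop :=
  least (fun t => (1 <= t)%N /\ v_linear_from I t) t0.

(* The vertex set {1, ..., n} is 'I_n. *)
Definition edge_ideal (e : rel 'I_n) : S -> Prop :=
  ideal_gen (fun f => exists i j : 'I_n, e i j /\ f = 'X_i * 'X_j).

End VNumber.

Arguments edge_ideal {n} k e _.

(* Main.v *)
Require Import Defs.
From Stdlib Require Import Classical.
From mathcomp Require Import all_boot all_order all_algebra.
From mathcomp Require Import mpoly zify.

(** Write I for the edge ideal. A prime P = (I^t : f) contains a variable,
    because it contains a power of an edge x_a x_b; hence x_c f lies in I^t for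
    some c, and I^t lives in degrees at least 2t. So v(I^t) >= 2t - 1 for all t,
    and the theorem follows from two facts about the set of those t >= 1 for
    which equality holds: it is upward closed, and it is not empty. For then
    v(I^t) = 2t - 1 from its least element on, while a line that agrees with v
    from t0 on must be 2t - 1, which puts t0 in the set.

    Upward closed ([vnumber_succ]). The key is I^(t+1) : I = I^t
    ([edge_ideal_pow_colon]). If P = (I^t : f) is prime, it is then the finite
    intersection of the ideals (I^(t+1) : f x_a x_b) over the edges ab, hence
    equal to one of them, and f x_a x_b has degree two more than f.

    The identity I^(t+1) : I = I^t is a statement about monomials m, regarded as
    multisets of vertices: m lies in I^t when t edges fit disjointly into m.
    Assume that t edges do not fit into m but that t + 1 do as soon as one more
    edge is added, whichever it is. Call packings of t - 1 edges into m maximum,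
    and say that vertices x, y are linked if no maximum packing leaves both
    uncovered. Adjacent vertices are linked, and Gallai's lemma
    ([misses_trans]) says that linkage is transitive through a vertex that
    some maximum packing leaves uncovered. Adding an edge ab to m produces a
    maximum packing that leaves uncovered a neighbour p of a and a neighbour q
    of b. Doing this with suitable edges gives adjacent a, b both left uncovered
    by maximum packings; for that edge ab the chain p - a - b - q makes p and q
    linked, a contradiction. Gallai's lemma itself comes from an exchange
    property of degree sequences of edge multisets ([edge_prod_exchange]),
    which replaces alternating paths.

    Not empty ([vnumber_attained]). Fix a vertex j and let N be the set of ends
    of walks of odd length from j. Along such a walk to i, the edges at even
    positions have a product d for which d x_i x_j is the product of the edges
    at odd positions, one more in number. Multiplying the d of all i in N gives
    one d, a product of t - 1 edges, with x_i (d x_j) in I^t for all i in N.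
    Conversely, a monomial without variables in N cannot bring d x_j into I^t:
    as G is connected, either N is everything, and the degree 2t - 1 is too
    small, or G is bipartite with N as one side, and the degree t - 1 in the
    variables of N is too small. So (I^t : d x_j) is the prime generated by the
    variables of N. *)

Set Implicit Arguments.
Unset Strict Implicit.
Unset Printing Implicit Defensive.

Import GRing.Theory.

(** * Packings of edges into monomials *)

Section EdgeProducts.
Local Open Scope nat_scope.
Variables (n : nat) (e : rel 'I_n).
Hypothesis e_sym : ssrbool.symmetric e.
Implicit Types (a b x y z i j : 'I_n) (p q m d : 'X_{1..n}).

(** Exponent vectors of products of [t] edges, equivalently degree sequences of
    multigraphs with [t] edges supported on [e]. *)
Inductive edge_prod : nat -> 'X_{1..n} -> Prop :=
| edge_prod0 : edge_prod 0 0%MM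
| edge_prodS t a b d : e a b -> edge_prod t d ->
    edge_prod t.+1 (U_(a) + U_(b) + d)%MM.

Lemma edge_prod1 a b : e a b -> edge_prod 1 (U_(a) + U_(b))%MM.
Proof. by move=> /edge_prodS /(_ edge_prod0); rewrite addm0. Qed.

Lemma edge_prodD s t p q :
  edge_prod s p -> edge_prod t q -> edge_prod (s + t) (p + q)%MM.
Proof.
elim=> [|s' a b d eab _ IH] Eq; first by rewrite add0m.
by rewrite addSn -addmA; apply: edge_prodS => //; apply: IH.
Qed.

Lemma edge_prod_mdeg t d : edge_prod t d -> mdeg d = 2 * t.
Proof. by elim=> [|t' a b d' _ _ IH]; rewrite ?mdeg0 // !mdegD !mdeg1 IH; lia. Qed.

Lemma edge_prod_extract t d y : edge_prod t d -> 0 < d y ->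
  exists s a d', [/\ t = s.+1, e y a, edge_prod s d' &
                     d = (U_(y) + U_(a) + d')%MM].
Proof.
elim=> [|t' a b d' eab Ed IH]; first by rewrite mnm0E.
have [<- _|nay] := eqVneq a y; first by exists t', b, d'.
have [<- _|nby] := eqVneq b y.
  by exists t', a, d'; split=> //; [rewrite e_sym | rewrite (addmC U_(b)%MM)].
rewrite !mnmDE !mnm1E (negPf nay) (negPf nby) => /IH [s [c [d'' [-> eyc Ed'' ->]]]].
exists s.+1, c, (U_(a) + U_(b) + d'')%MM; split=> //; first exact: edge_prodS.
by apply/mnmP=> i; rewrite !mnmDE; lia.
Qed.

(** The exchange property behind alternating paths: walk from [y], alternately
    moving an edge from the first multigraph to the second and back, until the
    degrees can be balanced at an end [b]. The walk has odd length in the first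
    case, where the second multigraph gains an edge, and even length in the
    second case. The comparisons at [b], made on the common parts [p'], [q'],
    say that the exchange is towards equality at [b]; this form also covers
    [b = y]. Only degrees are tracked, so no walk has to be constructed: moving
    one edge and swapping the roles of the two multigraphs is an induction on
    the total number of edges. *)
Lemma edge_prod_exchange s t p q y :
  edge_prod s p -> edge_prod t q -> q y < p y ->
  (exists s' b p',
     [/\ s = s'.+1, p = (p' + U_(y) + U_(b))%MM, q b <= p' b,
         edge_prod s' p' & edge_prod t.+1 (q + U_(y) + U_(b))%MM]) \/
  (exists b p' q',
     [/\ p = (p' + U_(y))%MM, q = (q' + U_(b))%MM, p' b <= q' b,
         edge_prod s (p' + U_(b))%MM & edge_prod t (q' + U_(y))%MM]).
Proof.
have [N] := ubnP (s + t); elim: N => // N IH in s t p q y * => ltN Ep Eq lt_y.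
have [|s1 [a [p1 [Ds eya Ep1 Dp]]]] := edge_prod_extract Ep (y := y); first by lia.
have addE c d r : (c + d + r = r + c + d :> 'X_{1..n})%MM by rewrite addmC addmA.
have [le_a|lt_a] := leqP (q a) (p1 a).
  (* the walk stops after one edge *)
  left; exists s1, a, p1; split=> //; first by rewrite Dp.
  by rewrite -addE; apply: edge_prodS.
subst s p.
have [|[t1 [b [q1 [Dt Dq le_b Eq1 Ep2]]]]|[b [q1 [p2 [Dq Dp le_b Eq1 Ep2]]]]] :=
  IH t s1 q p1 a _ Eq Ep1 lt_a; first by lia.
- right; exists b, (p1 + U_(a))%MM, (q1 + U_(a))%MM; split=> //.
  + by apply/mnmP=> i; rewrite !mnmDE; lia.
  + by rewrite !mnmDE; lia.
  + rewrite Dt [(_ + U_(y))%MM](_ : _ = U_(y) + U_(a) + q1)%MM.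
      exact: edge_prodS.
    by apply/mnmP=> i; rewrite !mnmDE; lia.
left; exists s1, b, (p2 + U_(a))%MM; split=> //.
- by rewrite Dp; apply/mnmP=> i; rewrite !mnmDE; lia.
- by rewrite Dq !mnmDE; lia.
rewrite [(_ + U_(b))%MM](_ : _ = U_(y) + U_(a) + (q1 + U_(b)))%MM.
  exact: edge_prodS.
by rewrite Dq; apply/mnmP=> i; rewrite !mnmDE; lia.
Qed.

(** The monomials of the [t]-th power of the edge ideal. *)
Definition mon_pow t m := exists2 d, edge_prod t d & (d <= m)%MM.

Lemma mon_pow0 m : mon_pow 0 m.
Proof.
by exists 0%MM; [exact: edge_prod0 | apply/mnm_lepP=> i; rewrite mnm0E].
Qed.

(** For [x = y] two copies of [x] in [m] are left uncovered, so that vertices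
    stand for any of their copies. *)
Definition misses t m x y := exists2 d, edge_prod t d & (d + U_(x) + U_(y) <= m)%MM.

Lemma misses_adj t m x y : e x y -> misses t m x y -> mon_pow t.+1 m.
Proof.
move=> exy [d Ed le]; exists (U_(x) + U_(y) + d)%MM; first exact: edge_prodS.
by rewrite addmC addmA.
Qed.

(** Gallai's lemma on maximum matchings, read contrapositively: take a packing
    that misses [x] and [z] and the packing [d] that misses [y]. Exchanging at
    [y] cannot enlarge [d], so it changes the first packing into one that misses
    [y], and covers at most one new vertex, so that [x] or [z] stays missed. *)
Lemma misses_trans t m x y z d : ~ mon_pow t.+1 m ->
  edge_prod t d -> (d + U_(y) <= m)%MM ->
  misses t m x z -> misses t m x y \/ misses t m y z.
Proof.
move=> nopow Ed /mnm_lepP led [p Ep /mnm_lepP lep].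
have [lty|gey] := ltnP (p y) (m y).
  have [<-|nxy] := eqVneq x y.
    by right; exists p => //; apply/mnm_lepP.
  left; exists p => //; apply/mnm_lepP=> i; have := lep i.
  rewrite !mnmDE !mnm1E; have [<-|_] := eqVneq y i; last by lia.
  by rewrite (negPf nxy); lia.
have ltdp : d y < p y by have := led y; rewrite mnmDE mnm1E eqxx; lia.
have [[s [b [p' [_ Dp le_b _ Ed']]]]|[b [p' [d' [Dp Dd le_b Ep' _]]]]] :=
  edge_prod_exchange Ep Ed ltdp.
  (* the exchange would enlarge the packing d *)
  case: nopow; exists (d + U_(y) + U_(b))%MM => //; apply/mnm_lepP=> i.
  have := lep i; have := led i; rewrite Dp !mnmDE !mnm1E.
  by have [<-|_] := eqVneq b i; lia.
subst p d; have [eq_bx|nbx] := eqVneq b x; [right|left]; exists (p' + U_(b))%MM => //;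
  apply/mnm_lepP=> i; have := lep i; have := led i; rewrite ?eq_bx !mnmDE !mnm1E.
  by lia.
by have [<-|_] := eqVneq b i; rewrite ?(eq_sym x) ?(negPf nbx); lia.
Qed.

Lemma mon_pow_drop t m : mon_pow t.+1 m -> mon_pow t m.
Proof.
case=> d Ed /mnm_lepP; case Dt: _ d / Ed => [//|s a b d _ Ed] le.
by case: Dt => ->; exists d => //; apply/mnm_lepP=> i; have := le i; rewrite !mnmDE; lia.
Qed.

(** A packing that only fits after adding [a] must use the new copy of [a];
    what remains after deleting its edge [ab] misses [b]. *)
Lemma edge_prod_cover t m a d : ~ mon_pow t.+1 m ->
  edge_prod t.+1 d -> (d <= m + U_(a))%MM ->
  exists b d', [/\ e a b, edge_prod t d', d = (U_(a) + U_(b) + d')%MM &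
                    (d' + U_(b) <= m)%MM].
Proof.
move=> nopow Ed /mnm_lepP le.
have da : 0 < d a.
  rewrite lt0n; apply/negP=> /eqP da0; apply: nopow; exists d => //.
  apply/mnm_lepP=> i; have := le i; rewrite mnmDE mnm1E.
  by case: eqVneq => [<-|_]; lia.
have [s [b [d' [[<-] eab Ed' Dd]]]] := edge_prod_extract Ed da.
exists b, d'; split=> //; apply/mnm_lepP=> i; have := le i.
by rewrite Dd !mnmDE; lia.
Qed.

(** Two edges of a packing into the enlarged monomial, one at the new copy of
    [a] and one at the new copy of [b], have to be deleted; their other ends are
    then missed. *)
Lemma edge_prod_cover2 t m a b : ~ mon_pow t.+1 m ->
  mon_pow t.+2 (m + U_(a) + U_(b))%MM ->
  exists x y, [/\ e a x, e b y & misses t m x y].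
Proof.
move=> nopow [d Ed led].
have nopow_a : ~ mon_pow t.+2 (m + U_(a))%MM.
  case=> d1 Ed1 le1; have [E|nE] := classic (mon_pow t.+2 m).
    by apply: nopow; apply: mon_pow_drop.
  have [c [d' [_ Ed' _ /mnm_lepP le']]] := edge_prod_cover nE Ed1 le1.
  apply: nopow; exists d' => //; apply/mnm_lepP=> i.
  by have := le' i; rewrite mnmDE; lia.
have [q [d1 [ebq Ed1 _ /mnm_lepP le1]]] := edge_prod_cover nopow_a Ed led.
have le1' : (d1 <= m + U_(a))%MM.
  by apply/mnm_lepP=> i; have := le1 i; rewrite !mnmDE; lia.
have [p [d2 [eap Ed2 Dd _]]] := edge_prod_cover nopow Ed1 le1'.
exists p, q; split=> //; exists d2 => //; apply/mnm_lepP=> i.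
by have := le1 i; rewrite Dd !mnmDE; lia.
Qed.

(** This is I^(t+1) : I = I^t on monomials. If [m] were outside I^t, packings of
    one edge less would be maximum, and adding the edge between two adjacent
    missable vertices [a], [b] would produce a path p - a - b - q of adjacent
    vertices with p and q missed together, against [misses_trans]. *)
Lemma mon_pow_colon t m : (exists a b, e a b) ->
  (forall a b, e a b -> mon_pow t.+1 (m + U_(a) + U_(b))%MM) -> mon_pow t m.
Proof.
case: t => [|t] [a0 [b0 e0]] pow; first exact: mon_pow0.
apply: NNPP => nopow.
have misssym x y : misses t m x y -> misses t m y x.
  by case=> d Ed le; exists d; rewrite // -addmA (addmC U_(y)%MM) addmA.
have missable x y : misses t m x y -> exists2 d, edge_prod t d & (d + U_(x) <= m)%MM.
  case=> d Ed /mnm_lepP le; exists d => //; apply/mnm_lepP=> i.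
  by have := le i; rewrite !mnmDE; lia.
have nadj x y : e x y -> ~ misses t m x y by move=> exy /(misses_adj exy).
(* one application of the hypothesis gives a missable vertex, a second one, at
   an edge containing it, gives an adjacent pair of missable vertices *)
have [a [_ [e0a _ /missable [da Eda leda]]]] := edge_prod_cover2 nopow (pow _ _ e0).
have {e0a} ea0 : e a a0 by rewrite e_sym.
have [b [_ [eab _ /missable [db Edb ledb]]]] := edge_prod_cover2 nopow (pow _ _ ea0).
have [p [q [eap ebq missed]]] := edge_prod_cover2 nopow (pow _ _ eab).
have [|missed'] := misses_trans nopow Eda leda missed.
  by apply: nadj; rewrite e_sym.
have [|] := misses_trans nopow Edb ledb missed'; exact: nadj.
Qed.
End EdgeProducts.

(** * Powers of the edge ideal *)

Local Open Scope ring_scope.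

Lemma ideal_gen_ideal (R : comNzRingType) (A : R -> Prop) : is_ideal (ideal_gen A).
Proof.
split=> [|f g [s As ->] [s' As' ->]|c f [s As ->]].
- by exists [::]; rewrite ?big_nil.
- exists (s ++ s'); last by rewrite big_cat.
  by move=> p; rewrite mem_cat => /orP[/As|/As'].
exists [seq (c * p.1, p.2) | p <- s]; first by move=> _ /mapP[p /As Ap ->].
by rewrite big_map big_distrr /=; apply: eq_bigr => p _; rewrite mulrA.
Qed.

Lemma mem_ideal_gen (R : comNzRingType) (A : R -> Prop) f : A f -> ideal_gen A f.
Proof.
move=> Af; exists [:: (1, f)]; first by move=> p; rewrite inE => /eqP->.
by rewrite big_seq1 mul1r.
Qed.

Lemma ideal_sum (R : comNzRingType) (J : R -> Prop) (T : eqType) (s : seq T) F :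
  is_ideal J -> (forall x, x \in s -> J (F x)) -> J (\sum_(x <- s) F x).
Proof.
by case=> J0 JD _ JF; rewrite big_seq; apply: big_ind => // x /JF.
Qed.

Section EdgeIdealPowers.
Variables (n : nat) (k : fieldType) (e : rel 'I_n).
Local Notation S := {mpoly k[n]}.
Local Notation I := (edge_ideal k e).
Implicit Types (f g : S) (m u : 'X_{1..n}).

Lemma edge_ideal_pow_edge_prod t d : edge_prod e t d -> ideal_pow I t 'X_[d].
Proof.
move=> Ed; apply: mem_ideal_gen; elim: Ed => [|{}t a b {}d eab _ [F IF Xd]].
  by exists (fun=> 0); [case | rewrite big_ord0 mpolyX0].
exists (fun i => if unlift ord0 i is Some j then F j else 'X_a * 'X_b).
  move=> i; case: unliftP => [j _|_]; first exact: IF.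
  by apply: mem_ideal_gen; exists a, b.
rewrite big_ord_recl unlift_none !mpolyXD Xd; congr (_ * _).
by apply: eq_bigr => j _; rewrite liftK.
Qed.

Lemma mon_powD s t p q : mon_pow e s p -> mon_pow e t q -> mon_pow e (s + t) (p + q)%MM.
Proof.
case=> d Ed /mnm_lepP led [d' Ed' /mnm_lepP led']; exists (d + d')%MM.
  exact: edge_prodD.
by apply/mnm_lepP=> i; rewrite !mnmDE leq_add.
Qed.

(** Powers of a monomial ideal are monomial ideals. *)
Lemma edge_ideal_powP t f :
  ideal_pow I t f <-> forall m, m \in msupp f -> mon_pow e t m.
Proof.
pose M s g := forall m, m \in msupp g -> mon_pow e s m.
have MM s1 s2 g1 g2 : M s1 g1 -> M s2 g2 -> M (s1 + s2)%N (g1 * g2).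
  by move=> M1 M2 m /msuppM_le/allpairsP[[p q] [/M1 ? /M2 ? ->]]; apply: mon_powD.
have Mgen s (A : S -> Prop) g : (forall h, A h -> M s h) -> ideal_gen A g -> M s g.
  move=> MA [l Al ->]; rewrite big_seq; apply: (big_ind (M s)) => [m|g1 g2 M1 M2 m|p lp].
  - by rewrite msupp0.
  - by move/msuppD_le; rewrite mem_cat => /orP[/M1|/M2].
  rewrite -[s]add0n; apply: (MM); last exact/MA/Al.
  by move=> m _; apply: mon_pow0.
split=> [|Mf].
  apply: (Mgen) => h [F IF ->].
  have IM i : M 1%N (F i).
    apply: (Mgen) (IF i) => {}h [a [b [eab ->]]] m.
    rewrite -mpolyXD => /mem_msuppXP <-; exists (U_(a) + U_(b))%MM => //.
      exact: edge_prod1.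
    exact: lepm_refl.
  elim: (t) F IM {IF} => [|s IH] F IM.
    rewrite big_ord0 => m _; exact: mon_pow0.
  by rewrite big_ord_recl; apply: (MM 1%N) => //; apply: IH.
rewrite [f]mpolyE; apply: ideal_sum => [|m /Mf [d Ed le]].
  exact: ideal_gen_ideal.
have [_ _ IM] : is_ideal (ideal_pow I t) by apply: ideal_gen_ideal.
rewrite -(submK le) mpolyXD -mul_mpolyC mulrA; apply: IM.
exact: edge_ideal_pow_edge_prod.
Qed.

Lemma edge_ideal_pow_mulX t f u :
  ideal_pow I t (f * 'X_[u]) <-> forall m, m \in msupp f -> mon_pow e t (m + u)%MM.
Proof.
rewrite edge_ideal_powP; split=> H m.
  by move=> mf; apply: H; rewrite (perm_mem (msuppMX _ _)) addmC map_f.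
by rewrite (perm_mem (msuppMX _ _)) => /mapP[m' /H m'P ->]; rewrite addmC.
Qed.

Lemma edge_ideal_pow_colon (e_sym : ssrbool.symmetric e)
    (e_edge : exists i j, e i j) t f :
  (forall a b, e a b -> ideal_pow I t.+1 (f * ('X_a * 'X_b))) -> ideal_pow I t f.
Proof.
move=> If; apply/edge_ideal_powP => m mf; apply: mon_pow_colon => // a b eab.
have := If a b eab; rewrite -mpolyXD => /edge_ideal_pow_mulX/(_ m mf).
by rewrite addmA.
Qed.

Lemma edge_ideal_pow_mulX_edge t f a b : e a b ->
  ideal_pow I t f -> ideal_pow I t.+1 (f * ('X_a * 'X_b)).
Proof.
move=> eab /edge_ideal_powP If; rewrite -mpolyXD; apply/edge_ideal_pow_mulX => m /If.
rewrite -addn1 => /mon_powD; apply; exists (U_(a) + U_(b))%MM; first exact: edge_prod1.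
exact: lepm_refl.
Qed.

Hypothesis e_edge : exists i j, e i j.

(** A power of an edge lies in I^t, hence in [P], so [P] contains a variable
    x_c, and x_c f is a nonzero element of I^t, whose degree is at least 2t. *)
Lemma vnumber_lower_bound t f P d : is_prime P ->
  ideal_eq (colon (ideal_pow I t) f) P -> has_deg f d -> (2 * t - 1 <= d)%N.
Proof.
case=> _ P1 PM colP degf; have [a [b eab]] := e_edge.
have [c Pc] : exists c, P 'X_c.
  suff [] : P 'X_a \/ P 'X_b by [exists a | exists b].
  have {}PX g s : P (g ^+ s) -> P g.
    by elim: s => [//|s IH]; rewrite exprS => /PM[].
  apply/PM/(PX _ t)/colP; rewrite /colon mulrC.
  elim: (t) {colP} => [|s IH].
    rewrite expr0 mulr1; apply/edge_ideal_powP => m _.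
    exact: mon_pow0.
  by rewrite exprSr mulrA; apply: edge_ideal_pow_mulX_edge.
have nz_f : f != 0 by apply/eqP=> f0; move: degf; rewrite /has_deg f0 msize0.
have /colP := Pc; rewrite /colon mulrC => /edge_ideal_pow_mulX/(_ _ (mlead_supp nz_f)).
case=> d' Ed' le; have := edge_prod_mdeg Ed'; have := msize_mdeg_lt (mlead_supp nz_f).
rewrite degf; have : (mdeg d' <= mdeg (mlead f + U_(c))%MM)%N.
  by rewrite !mdegE; apply: leq_sum => i _; apply/mnm_lepP.
rewrite mdegD mdeg1; lia.
Qed.

Lemma vnumber_min t f P : is_prime P ->
  ideal_eq (colon (ideal_pow I t) f) P -> has_deg f (2 * t - 1)%N ->
  is_vnumber (ideal_pow I t) (2 * t - 1)%N.
Proof.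
move=> prP colP degf; split=> [|d [Q [prQ _] [[g degg colQ] _]]].
  exists P; first by split=> //; exists f.
  split=> [|d [g degg colg]]; first by exists f.
  exact: vnumber_lower_bound colg degg.
exact: vnumber_lower_bound colQ degg.
Qed.

(** As [P] = (I^t : f) = (I^(t+1) : f I) is the intersection of the ideals
    (I^(t+1) : f x_a x_b) over the edges, and [P] is prime, it is one of them:
    otherwise a product of elements of these ideals outside [P] would lie in the
    intersection. *)
Lemma vnumber_succ (e_sym : ssrbool.symmetric e) t : (1 <= t)%N ->
  is_vnumber (ideal_pow I t) (2 * t - 1)%N ->
  is_vnumber (ideal_pow I t.+1) (2 * t.+1 - 1)%N.
Proof.
move=> t_gt0 [[P [prP _] [[f degf colP] _]] _].
have nz_f : f != 0 by apply/eqP=> f0; move: degf; rewrite /has_deg f0 msize0.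
have [_ P1 PM] := prP.
suff [a [b [eab sub]]] : exists a b, e a b /\
    forall g, colon (ideal_pow I t.+1) (f * ('X_a * 'X_b)) g -> P g.
  apply: (@vnumber_min _ (f * ('X_a * 'X_b)) P) => // [g|].
    split=> [|/colP]; first exact: sub.
    by rewrite /colon (mulrA g); apply: edge_ideal_pow_mulX_edge.
  rewrite /has_deg -mpolyXD msizeM // ?msizeX ?mdegD ?mdeg1 ?degf; last first.
    by rewrite -msize_poly_eq0 msizeX.
  by lia.
apply: NNPP => nosub.
have witness (ab : 'I_n * 'I_n) : exists g,
    ~ P g /\ (e ab.1 ab.2 -> ideal_pow I t.+1 (g * (f * ('X_ab.1 * 'X_ab.2)))).
  have [eab|neab] := boolP (e ab.1 ab.2); last by exists 1.
  apply: NNPP => nog; apply: nosub; exists ab.1, ab.2; split=> // g colg.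
  by apply: NNPP => nPg; apply: nog; exists g.
have [F FP] := fin_all_exists witness.
have nPF : ~ P (\prod_ab F ab).
  apply: (big_ind (fun g => ~ P g)) => // [g h nPg nPh /PM[]//|ab _].
  by case: (FP ab).
apply/nPF/colP/edge_ideal_pow_colon => // a b eab; rewrite -mulrA.
rewrite (bigD1 (a, b)) //= mulrAC mulrC; have [_ /(_ eab)] := FP (a, b).
by have [_ _] : is_ideal (ideal_pow I t.+1) := ideal_gen_ideal _; apply.
Qed.

End EdgeIdealPowers.

(** * Primes generated by variables *)

Section VariablePrimes.
Variables (n : nat) (k : fieldType) (N : pred 'I_n).
Local Notation S := {mpoly k[n]}.

(** The ideal generated by the variables in [N], through its monomials. *)
Definition var_ideal (g : S) : Prop :=
  forall m, m \in msupp g -> exists2 i, N i & (0 < m i)%N.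

Let kill : n.-tuple S := [tuple if N i then 0 else 'X_i | i < n].

(** Primality is read off from this kernel description, the target of the
    substitution being a domain. *)
Lemma var_ideal_kill g : var_ideal g <-> g \mPo kill = 0.
Proof.
pose hit (m : 'X_{1..n}) := [exists i, N i && (0 < m i)%N].
have killX m : 'X_[m] \mPo kill = if hit m then 0 else 'X_[m].
  rewrite comp_mpolyX; case: ifPn => [/existsP[i /andP[Ni mi]]|].
    by rewrite (bigD1 i) //= tnth_mktuple Ni expr0n eqn0Ngt mi mul0r.
  rewrite negb_exists => /forallP nhit; rewrite [RHS]mpolyXE_id; apply: eq_bigr => i _.
  rewrite tnth_mktuple; case: ifP => // Ni; have := nhit i.
  by rewrite Ni -eqn0Ngt => /eqP->; rewrite !expr0.
have coefK m : (g \mPo kill)@_m = if hit m then 0 else g@_m.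
  rewrite comp_mpolyEX raddf_sum /= (eq_bigr (fun m' => if m' == m then
    if hit m then 0 else g@_m else 0)); last first.
    move=> m' _; rewrite mcoeffZ killX; have [->|nm] := eqVneq m' m.
      by case: ifP => _; rewrite ?mcoeff0 ?mulr0 // mcoeffX eqxx mulr1.
    by case: ifP => _; rewrite ?mcoeff0 ?mulr0 // mcoeffX (negPf nm) mulr0.
  rewrite -big_mkcond /=; have [mg|nmg] := boolP (m \in msupp g).
    by rewrite -big_filter filter_pred1_uniq ?msupp_uniq // big_seq1.
  rewrite big_seq_cond big1 => [|m' /andP[m'g /eqP Dm]].
    by rewrite memN_msupp_eq0 ?if_same.
  by rewrite -Dm m'g in nmg.
split=> [hitg|g0 m].
  apply/mpolyP=> m; rewrite coefK mcoeff0; case: ifPn => // nhit.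
  apply: memN_msupp_eq0; apply: contra nhit => /hitg[i Ni mi].
  by apply/existsP; exists i; rewrite Ni.
rewrite mcoeff_msupp; have := coefK m; rewrite g0 mcoeff0.
case: ifPn => [/existsP[i /andP[Ni mi]] _ _|_ <-]; first by exists i.
by rewrite eqxx.
Qed.

Lemma var_ideal_prime : is_prime var_ideal.
Proof.
split=> [||f g]; first split=> [|f g|c f].
- by apply/var_ideal_kill; rewrite raddf0.
- by move=> /var_ideal_kill f0 /var_ideal_kill g0; apply/var_ideal_kill;
     rewrite raddfD /= f0 g0 addr0.
- by move=> /var_ideal_kill f0; apply/var_ideal_kill; rewrite rmorphM /= f0 mulr0.
- by move/var_ideal_kill/eqP; rewrite rmorph1 oner_eq0.
move/var_ideal_kill/eqP; rewrite rmorphM mulf_eq0.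
by case/orP=> /eqP ?; [left|right]; apply/var_ideal_kill.
Qed.
End VariablePrimes.

(** * A power whose v-number is minimal *)

Section Existence.
Variables (n : nat) (k : fieldType) (e : rel 'I_n).
Hypothesis e_sym : ssrbool.symmetric e.
Hypothesis e_conn : forall i j : 'I_n, connect e i j.
Hypothesis e_edge : exists i j : 'I_n, e i j.
Local Notation I := (edge_ideal k e).

(** Walks of a given parity in a graph are walks in its bipartite double cover,
    so that their ends are obtained from [connect]. *)
Definition double_cover : rel ('I_n * bool) :=
  fun u v => e u.1 v.1 && (v.2 == ~~ u.2).

Definition walk_of_parity (odd : bool) j : pred 'I_n :=
  fun i => connect double_cover (j, false) (i, odd).

Lemma walk_of_parity_edge odd j i x : e i x ->
  walk_of_parity odd j i -> walk_of_parity (~~ odd) j x.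
Proof.
move=> eix /connect_trans; apply; apply: connect1.
by rewrite /double_cover /= eix eqxx.
Qed.

(** Split the edges of the walk alternately into two classes: every inner vertex
    occurs once in each class, and the class of the first and last edges has one
    edge more. *)
Lemma odd_walk_edge_prod j i : walk_of_parity true j i ->
  exists t d, edge_prod e t d /\ edge_prod e t.+1 (d + U_(i) + U_(j))%MM.
Proof.
(* for even walks the two classes have equally many edges, and the end and the
   start of the walk are each covered by one class only *)
pose W (v : 'I_n * bool) := exists t d,
  edge_prod e t (if v.2 then d else d + U_(v.1))%MM /\
  edge_prod e (t + v.2) ((if v.2 then d + U_(v.1) else d) + U_(j))%MM.
suff WP v : connect double_cover (j, false) v -> W v.
  move/WP => [t [d []]]; rewrite /= addn1 => Ed Ed'; by exists t, d.
case/connectP=> p pathp ->{v}; elim/last_ind: p pathp => [_|p v IH].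
  have [a [b eab]] := e_edge.
  have [c ejc] : exists c, e j c.
    case/connectP: (e_conn j a) => [[|c q]] /= => [_ <-|/andP[ejc _] _].
      by exists b.
    by exists c.
  (* a trivial walk is replaced by j - c - j *)
  by exists 1%N, U_(c)%MM; split; apply: edge_prod1; rewrite e_sym.
rewrite rcons_path last_rcons => /andP[/IH {IH}]; case: v => x c.
case: (last _ p) => z odd [t [d [E1 E2]]] /andP[/= ezx /eqP ->].
case: odd E1 E2 => /= E1 E2.
  exists t.+1, (d + U_(z))%MM; rewrite addn0 /=; split; last by rewrite -addn1.
  by rewrite -addmA addmC; apply: edge_prodS.
exists t, (d + U_(z))%MM; split=> //.
rewrite addn0 in E2; rewrite addn1.
suff -> : (d + U_(z) + U_(x) + U_(j) = U_(z) + U_(x) + (d + U_(j)))%MM.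
  exact: edge_prodS.
by apply/mnmP=> y; rewrite !mnmDE; lia.
Qed.

(** Multiplying by further edges keeps the property of a single walk, so the
    products found for the various ends can be multiplied together. *)
Lemma odd_walks_edge_prod j : exists t d, edge_prod e t d /\
  forall i, walk_of_parity true j i -> edge_prod e t.+1 (d + U_(i) + U_(j))%MM.
Proof.
have pick i : exists td : nat * 'X_{1..n}, edge_prod e td.1 td.2 /\
    (walk_of_parity true j i -> edge_prod e td.1.+1 (td.2 + U_(i) + U_(j))%MM).
  have [/odd_walk_edge_prod[t [d [Ed Ed']]]|_] := boolP (walk_of_parity true j i).
    by exists (t, d).
  by exists (0%N, 0%MM); split=> //; exact: edge_prod0.
have [F FP] := fin_all_exists pick.
have Esum (Q : pred 'I_n) :
    edge_prod e (\sum_(i | Q i) (F i).1)%N (\sum_(i | Q i) (F i).2)%MM.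
  apply: (big_ind2 (edge_prod e)) => [|s p t q Ep Eq|i _].
  - exact: edge_prod0.
  - exact: edge_prodD.
  by have [] := FP i.
exists (\sum_i (F i).1)%N, (\sum_i (F i).2)%MM; split; first exact: Esum.
move=> i odd_i; rewrite (bigD1 i) //= [X in (X + _ + _)%MM](bigD1 i) //=.
rewrite -addSn; have [_ /(_ odd_i) Ei] := FP i.
set A := (F i).2 in Ei *; set B := (\sum_(_ | _) _)%MM.
suff -> : (A + B + U_(i) + U_(j) = A + U_(i) + U_(j) + B)%MM.
  exact: edge_prodD.
by apply/mnmP=> y; rewrite !mnmDE; lia.
Qed.

(** Double counting: if [N] is one side of a bipartition, each edge contributes
    one to the degree in the variables of [N]. *)
Lemma weight_edge_prod (N : pred 'I_n) t d :
  (forall a b, e a b -> N a != N b) -> edge_prod e t d ->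
  (\sum_(i | N i) d i = t)%N.
Proof.
move=> cut; have weight1 a : (\sum_(i | N i) U_(a)%MM i = N a)%N.
  rewrite big_mkcond (bigD1 a) //= mnm1E eqxx big1 ?addn0; first by case: (N a).
  by move=> i nia; rewrite mnm1E eq_sym (negPf nia) if_same.
elim=> [|s a b {}d eab _ IH]; first by rewrite big1 // => i _; rewrite mnm0E.
rewrite (eq_bigr (fun i => U_(a)%MM i + U_(b)%MM i + d i)%N); last first.
  by move=> i _; rewrite !mnmDE.
by rewrite !big_split /= !weight1 IH; case: (N a) (N b) (cut _ _ eab) => [] [].
Qed.

(** By connectedness every vertex ends an odd or an even walk from [j]. If one
    vertex ends both, all do, and the total degree is too small; otherwise the
    two kinds form a bipartition, and the degree in the odd vertices is too
    small. *)
Lemma mon_pow_odd_walk j t d m : edge_prod e t d ->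
  mon_pow e t.+1 (m + (d + U_(j)))%MM ->
  exists2 i, walk_of_parity true j i & (0 < m i)%N.
Proof.
move=> Ed [p Ep /mnm_lepP le].
set N := walk_of_parity true j; set B := walk_of_parity false j.
apply: NNPP => nohit; have m0 i : N i -> m i = 0%N.
  move=> Ni; apply/eqP; rewrite eqn0Ngt; apply/negP=> mi.
  by apply: nohit; exists i.
have le_sum (Q : pred 'I_n) : (\sum_(i | Q i) p i <=
    \sum_(i | Q i) m i + \sum_(i | Q i) d i + \sum_(i | Q i) U_(j)%MM i)%N.
  rewrite -!big_split /=; apply: leq_sum => i _.
  by have := le i; rewrite !mnmDE addnA.
have NB a b : e a b -> N a -> B b by exact: (@walk_of_parity_edge true).
have BN a b : e a b -> B a -> N b by exact: (@walk_of_parity_edge false).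
have spread (Q : pred 'I_n) i :
    (forall a b, e a b -> Q a -> Q b) -> Q i -> forall x, Q x.
  move=> closed Qi x; case/connectP: (e_conn i x) => q.
  elim: q i Qi => [|y q IH] i Qi /=; first by move=> _ ->.
  by case/andP=> /closed/(_ Qi) Qy; apply: IH.
have Bj : B j by exact: connect0.
have cover i : N i || B i.
  apply: (spread [pred i | N i || B i] j) => [a b eab /orP[Na|Ba]|] /=.
  - by rewrite (NB _ _ eab Na) orbT.
  - by rewrite (BN _ _ eab Ba).
  by rewrite Bj orbT.
have [/existsP[i /andP[Ni Bi]]|] := boolP [exists i, N i && B i].
  have allN x : N x.
    suff /andP[] : N x && B x by [].
    apply: (spread [pred i | N i && B i] i) x; last by rewrite /= Ni.
    by move=> a b eab /= /andP[Na Ba]; rewrite (NB a b) // (BN a b).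
  have := le_sum xpredT; rewrite -!mdegE mdeg1 (edge_prod_mdeg Ed) (edge_prod_mdeg Ep).
  by rewrite mdegE big1 => [|x _]; [lia | exact: m0].
rewrite negb_exists => /forallP disj.
have cut a b : e a b -> N a != N b.
  move=> eab; case Na: (N a).
    by move: (disj b); rewrite (NB _ _ eab Na) andbT => /negPf->.
  by have := cover a; rewrite Na => Ba; rewrite (BN _ _ eab Ba).
have := le_sum N; rewrite (weight_edge_prod cut Ep) (weight_edge_prod cut Ed).
rewrite [X in (_ <= X + _ + _)%N]big1 //.
rewrite [X in (_ <= _ + X)%N]big1 => [|i Ni]; first by lia.
rewrite mnm1E; case: eqP Ni (disj i) => // <- ->; by rewrite Bj.
Qed.

Lemma vnumber_attained : exists2 t, (1 <= t)%N &
  is_vnumber (ideal_pow I t) (2 * t - 1)%N.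
Proof.
have [j _] := e_edge; have [t [d [Ed odd_d]]] := odd_walks_edge_prod j.
exists t.+1 => //.
apply: (@vnumber_min _ _ _ e_edge _ 'X_[d + U_(j)] (var_ideal (walk_of_parity true j))).
- exact: var_ideal_prime.
- move=> g; split=> [/edge_ideal_pow_mulX Ig m /Ig|Pg].
    exact: mon_pow_odd_walk.
  apply/edge_ideal_pow_mulX => m /Pg[i odd_i mi].
  exists (d + U_(i) + U_(j))%MM; first exact: odd_d.
  apply/mnm_lepP=> x; rewrite !mnmDE !mnm1E.
  by case: (eqVneq i x) => [<-|_]; lia.
by rewrite /has_deg msizeX mdegD mdeg1 (edge_prod_mdeg Ed); lia.
Qed.
End Existence.

(** * The v-stability index *)

Lemma least_exists (A : nat -> Prop) : (exists t, A t) -> exists s, least A s.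
Proof.
case=> t At; apply: NNPP => noleast.
have: forall s, A s -> False; last by move/(_ t At).
elim/ltn_ind=> s IH As; apply: noleast; exists s; split=> // j Aj.
by rewrite leqNgt; apply/negP=> /IH; apply.
Qed.

Theorem lemma2p2 (n : nat) (k : fieldType) (e : rel 'I_n)
  (e_sym : ssrbool.symmetric e) (e_irr : irreflexive e)
  (e_conn : forall i j : 'I_n, connect e i j)
  (e_edge : exists i j : 'I_n, e i j) :
  exists s : nat,
    is_vstab (edge_ideal k e) s /\
    least (fun t => (1 <= t)%N /\
             is_vnumber (ideal_pow (edge_ideal k e) t) (2 * t - 1)%N) s.
Proof.
set I := edge_ideal k e.
pose A t := (1 <= t)%N /\ is_vnumber (ideal_pow I t) (2 * t - 1)%N.
have up t t' : (t <= t')%N -> A t -> A t'.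
  move=> le_tt' [t_gt0 vt]; split; first exact: leq_trans le_tt'.
  elim: t' le_tt' => [|t' IH]; first by case: t t_gt0 vt.
  rewrite leq_eqVlt => /predU1P[<- //|lt_tt'].
  by apply: vnumber_succ => //; [exact: leq_trans t_gt0 lt_tt' | apply: IH].
have [s [As le_s]] : exists s, least A s.
  apply: least_exists; have [t t_gt0 vt] := vnumber_attained k e_sym e_conn e_edge.
  by exists t.
exists s; split; last by [].
split=> [|t [t_gt0 [a [b lin]]]].
  have [s_gt0 _] := As; split=> //; exists 2, (-1) => t le_st.
  have [t_gt0 vt] := up _ _ le_st As; exists (2 * t - 1)%N => //; lia.
apply: le_s; split=> //.
have line r : (t <= r)%N -> A r -> (2 * r - 1)%N%:Z = a * r%:Z + b.
  by move=> le_tr [_ vr]; have [d vd <-] := lin r le_tr; rewrite (least_unique vr vd).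
(* beyond both s and t the two lines agree at r and r + 1, hence coincide *)
pose r := maxn s t.
have r_gt0 : (0 < r)%N by rewrite leq_max t_gt0 orbT.
have Ar : A r by apply: up As; apply: leq_maxl.
have := line r (leq_maxr _ _) Ar.
have := line r.+1 (leqW (leq_maxr _ _)) (up _ _ (leqnSn _) Ar).
have [d vd Dd] := lin t (leqnn t).
rewrite intS mulrDr mulr1 => E1 E2.
have Da : a = 2 by lia.
by have -> : (2 * t - 1 = d)%N by lia.
Qed.
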